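(* Let $A\geq a\geq 1$ and $r\geq 2$ be integers, and let $N\widetilde{mes}_{r,A,a}$ be the set of overpartitions $\pi$ such that all parts of $\pi$ of size $\equiv a\pmod A$ and less than $\widetilde{mes}_{r,A,a}(\pi)$ are non-overlined. Then \[ \sum_{\pi \in N\widetilde{mes}_{r,A,a}}z^{\widetilde{mes}_{r,A,a}(\pi)}q^{|\pi|}=\frac{(-q;q)_{\infty }}{(q;q)_{\infty}}\sum_{k=0}^{\infty }z^{kA+a}\bigg[\frac{q^{(r-1)[A\binom{k}{2}+ka]}}{(-q^{a};q^{A})_{k+1 }}-\frac{q^{(r-1)[A\binom{k+1}{2}+(k+1)a]}}{(-q^{a};q^{A})_{k+1}}\bigg]. \]
   Context: An overpartition is a partition (finite non-increasing sequence of positive integers) in which the first occurrence of each part value may be overlined; $|\pi|$ is the sum of parts. A part is of size $t$ if it equals $t$ or $\overline{t}$. $(a;q)_\infty=\prod_{i\geq0}(1-aq^i)$, $(a;q)_n=(a;q)_\infty/(aq^n;q)_\infty$; $|q|<1$, $z$ a formal variable. For $r\geq2$, $\widetilde{mes}_{r,A,a}(\pi)$ is the smallest positive integer $m\equiv a\pmod A$ such that $\pi$ has no overlined part $\overline{m}$ and $\pi$ has fewer than $r-1$ non-overlined parts equal to $m$. *)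

(* Defs.v *)
From HB Require Import structures.
From mathcomp Require Import all_boot all_order all_algebra.
From mathcomp Require Import complex finmap zify.
From mathcomp Require Import all_classical all_reals all_analysis.
From mathcomp.analysis Require showcase.summability.

Set Implicit Arguments.
Unset Strict Implicit.
Unset Printing Implicit Defensive.

Import Order.TTheory GRing.Theory Num.Theory.
Import numFieldNormedType.Exports.

Local Open Scope classical_set_scope.
Local Open Scope ring_scope.

(* A part is a pair (size, overlined?).  The pairwise condition says that an
   overlined part has no earlier part of the same size, i.e. that only first
   occurrences are overlined. *)
Definition is_overpartition (s : seq (nat * bool)) : bool :=
  [&& sorted geq (unzip1 s), all (leq 1) (unzip1 s) &
      pairwise (fun x y => y.2 ==> (x.1 != y.1)) s].

Record overpartition := Overpartition {
  parts :> seq (nat * bool);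
  _ : is_overpartition parts }.

HB.instance Definition _ := [isSub for parts].
HB.instance Definition _ := [Countable of overpartition by <:].

Definition weight (p : overpartition) : nat := sumn (unzip1 p).

Definition mes_candidate (r A a : nat) (p : overpartition) (m : nat) : Prop :=
  [/\ (0 < m)%N, m = a %[mod A], (m, true) \notin parts p
    & (count_mem (m, false) p < r - 1)%N].

(* The default value 0 is never used when A >= 1 and r >= 2: see mesP. *)
Definition mes (r A a : nat) (p : overpartition) : nat :=
  xget 0%N [set m | mes_candidate r A a p m /\
                    forall n, mes_candidate r A a p n -> (m <= n)%N].

Lemma mesP (r A a : nat) (p : overpartition) : (1 <= A)%N -> (2 <= r)%N ->
  mes_candidate r A a p (mes r A a p) /\
  forall n, mes_candidate r A a p n -> (mes r A a p <= n)%N.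
Proof.
move=> A1 r2.
have big b n : (n, b) \in parts p -> (n <= weight p)%N.
  rewrite /weight; elim: (parts p) => //= x s IH.
  by rewrite inE => /orP[/eqP <- /=|/IH]; lia.
have ex : exists n, `[< mes_candidate r A a p n >].
  exists (a + A * (weight p).+1)%N; apply/asboolP.
  have nin b : ((a + A * (weight p).+1)%N, b) \notin parts p.
    by apply/negP => /big; nia.
  split; [nia | by rewrite addnC mulnC modnMDl | exact: nin |].
  by rewrite (count_memPn (nin false)); lia.
rewrite /mes; apply: (@xgetPex _ 0%N [set m | mes_candidate r A a p m /\ _]).
case: (ex_minnP ex) => m /asboolP mm mmin; exists m; split=> // n nn.
by apply: mmin; apply/asboolP.
Qed.

Definition Nmes (r A a : nat) : set overpartition :=
  [set p | forall x, x \in parts p -> x.1 = a %[mod A] ->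
           (x.1 < mes r A a p)%N -> x.2 = false].

Definition qpoch_inf (K : numFieldType) (x q : K) : K :=
  lim (\prod_(i < n) (1 - x * q ^+ i) @[n --> \oo]).

Definition qpoch (K : numFieldType) (x q : K) (n : nat) : K :=
  qpoch_inf x q / qpoch_inf (x * q ^+ n) q.

(* A formal power series in z over K is its coefficient sequence nat -> K;
   zmonomial e c is c z^e. *)
Definition zmonomial (K : numFieldType) (e : nat) (c : K) : nat -> K :=
  fun m => if m == e then c else 0.

(* Sums of families of power series in z, taken coefficientwise; each
   coefficient is an unordered sum (the limit of the finite partial sums along
   the directed set of finite subsets of the index type). *)
Definition zsummable (K : numFieldType) (I : choiceType) (S : set I)
    (t : I -> nat -> K) : Prop :=
  forall m, cvg (summability.partial_sum
                   (fun i => if i \in S then t i m else 0)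
                 @ summability.totally).

Definition zsum (K : numFieldType) (I : choiceType) (S : set I)
    (t : I -> nat -> K) : nat -> K :=
  fun m => summability.sum (fun i => if i \in S then t i m else 0).

(* Main.v *)
Require Import Defs.
From mathcomp Require Import all_boot all_order all_algebra.
From mathcomp Require Import complex finmap.
From mathcomp Require Import all_classical all_reals all_analysis.
From mathcomp.analysis Require Import showcase.summability.
From mathcomp Require Import zify ring.

Set Implicit Arguments.
Unset Strict Implicit.
Unset Printing Implicit Defensive.

Import Order.TTheory GRing.Theory Num.Theory.
Import numFieldNormedType.Exports.

Local Open Scope classical_set_scope.
Local Open Scope complex_scope.
Local Open Scope ring_scope.

(** An overpartition is the same as a finitely supported choice, for every size
    n >= 1, of a bit (is the overlined n present?) and a multiplicity (of the
    non-overlined n). For m = kA + a, membership in Nmes with mes equal to m is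
    a condition on each size separately: a size n < m with n = a mod A has no
    overlined part and multiplicity at least r - 1, the size m has no overlined
    part and multiplicity below r - 1, and the other sizes are free. Hence the
    coefficient of z^m is a product over n of geometric sums; dividing by the
    unrestricted product of the (1 + q^n) / (1 - q^n) leaves finitely many
    factors, which give the bracket in the theorem.

    Analytically, the sum over overpartitions is compared with its partial sums
    over boxes (sizes at most N, multiplicities at most M), which factor; then
    M and N go to infinity in turn. Absolute convergence comes from a positive
    lower bound on the partial products of (1 - |q|^n). *)

(** * Unordered sums and absolute convergence *)

Lemma partial_sumE (I : choiceType) (V : zmodType) (t : I -> V) (J : {fset I}) :
  partial_sum t J = \sum_(i <- J) t i.
Proof. by rewrite /partial_sum big_seq_fsetE. Qed.

Lemma partial_sumD (I : choiceType) (V : zmodType) (s t : I -> V) (J : {fset I}) :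
  partial_sum (fun i => s i + t i) J = partial_sum s J + partial_sum t J.
Proof. exact: big_split. Qed.

Lemma ler_sum_sub (I : eqType) (K : numDomainType) (f : I -> K) (s1 s2 : seq I) :
  (forall i, 0 <= f i) -> uniq s1 -> uniq s2 -> {subset s1 <= s2} ->
  \sum_(i <- s1) f i <= \sum_(i <- s2) f i.
Proof.
move=> f0 u1 u2 s12; rewrite [leRHS](bigID (mem s1)) /= -[X in X + _]big_filter.
have /(perm_big _) -> : perm_eq [seq i <- s2 | i \in s1] s1.
  apply: uniq_perm; rewrite ?filter_uniq// => i.
  by rewrite mem_filter /=; case: (boolP (i \in s1)) => // /s12 ->.
by rewrite lerDl sumr_ge0.
Qed.

Lemma partial_sum_le (I : choiceType) (K : numDomainType) (f : I -> K)
    (J1 J2 : {fset I}) : (forall i, 0 <= f i) -> (J1 `<=` J2)%fset ->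
  partial_sum f J1 <= partial_sum f J2.
Proof.
move=> f0 /fsubsetP J12; rewrite !partial_sumE.
by apply: ler_sum_sub => //; exact: fset_uniq.
Qed.

(* The only completeness property of the field that is used; bounds are in K
   itself, so it makes sense for R[i], whose norm takes values in R[i]. *)
Definition abs_complete (K : numFieldType) :=
  forall (I : choiceType) (t : I -> K) (c : K),
  (forall J : {fset I}, partial_sum (fun i => `|t i|) J <= c) ->
  cvg (partial_sum t @ totally).

#[local] Existing Instance totally_filter.

(** The limit is the supremum of the partial sums: one of them comes within [e] of it, and by
    monotonicity so do all those over larger finite sets. *)
Lemma nonneg_summable (R : realType) (I : choiceType) (t : I -> R) (c : R) :
  (forall i, 0 <= t i) -> (forall J : {fset I}, partial_sum t J <= c) ->
  cvg (partial_sum t @ totally).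
Proof.
move=> t0 tc; set E := range (partial_sum t).
have supE : has_sup E.
  split; first by exists (partial_sum t fset0); exists fset0.
  by exists c => _ [J _ <-].
apply/cvg_ex; exists (sup E); apply/cvgrPdist_lt => e e0.
have [_ [J0 _ <-] J0e] := sup_adherent e0 supE.
exists J0 => // J /= J0J; have leJ := partial_sum_le t0 J0J.
have leS : partial_sum t J <= sup E by apply: ub_le_sup; [case: supE | exists J].
rewrite ger0_norm ?subr_ge0// ltrBlDr -ltrBlDl.
exact: lt_le_trans leJ.
Qed.

(** Write [t] as [(|t| + t) - |t|], a difference of two nonnegative families whose partial sums are
    bounded by [c + c] and [c]. *)
Lemma abs_complete_real (R : realType) : abs_complete R.
Proof.
move=> I t c tc.
have cv1 : cvg (partial_sum (fun i => `|t i|) @ totally) by exact: nonneg_summable tc.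
have cv2 : cvg (partial_sum (fun i => `|t i| + t i) @ totally).
  apply: (@nonneg_summable _ _ _ (c + c)) => [i|J].
    by rewrite -lerBlDr sub0r -normrN ler_norm.
  rewrite partial_sumD lerD// (le_trans _ (tc J))// ler_sum// => i _.
  exact: ler_norm.
have -> : partial_sum t = partial_sum (fun i => `|t i| + t i)
                        \- partial_sum (fun i => `|t i|).
  by apply/funext => J /=; rewrite partial_sumD addrC addKr.
exact: is_cvgB.
Qed.

Lemma normc_le_ReIm (R : realType) (z : R[i]) : `|z| <= (`|complex.Re z| + `|complex.Im z|)%:C.
Proof.
rewrite {1}(complexE z) (le_trans (ler_normD _ _))// rmorphD/= lerD//.
  by rewrite normc_def /= expr0n addr0 sqrtr_sqr.
by rewrite normrM !normc_def /= !expr0n/= expr1n add0r addr0 sqrtr1 mul1r sqrtr_sqr.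
Qed.

Lemma partial_sum_complex (R : realType) (I : choiceType) (t : I -> R[i])
    (J : {fset I}) :
  partial_sum t J = partial_sum (fun i => complex.Re (t i)) J
    +i* partial_sum (fun i => complex.Im (t i)) J.
Proof.
apply/eqP; rewrite eq_complex /partial_sum; apply/andP; split => /=; apply/eqP.
  exact: (raddf_sum (@complex.Re R : Rcomplex R -> R)).
exact: (raddf_sum (@complex.Im R : Rcomplex R -> R)).
Qed.

Lemma normc_ge_Im (R : realType) (z : R[i]) : `|complex.Im z|%:C <= `|z|.
Proof.
rewrite normc_def lecR -sqrtr_sqr ler_wsqrtr//.
by rewrite lerDr sqr_ge0.
Qed.

Lemma dist_lt_is_cvg (K : numFieldType) (T : Type) (F : set_system T)
    (FF : Filter F) (f : T -> K) (l : K) :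
  (forall e, 0 < e -> \forall x \near F, `|l - f x| < e) -> cvg (f @ F).
Proof. by move=> fl; apply/cvg_ex; exists l; apply/cvgrPdist_lt. Qed.

(** Real and imaginary parts are dominated by the norm, so the real case applies to each of them. *)
Lemma abs_complete_complex (R : realType) : abs_complete R[i].
Proof.
move=> I t c tc.
have bound (f : R[i] -> R) : (forall z, `|f z|%:C <= `|z|) -> forall J : {fset I},
    partial_sum (fun i => `|f (t i)|) J <= complex.Re c.
  (* The order of [R[i]] compares real parts and demands equal imaginary parts, so the bound [c] on
     sums of norms gives the real bound [Re c]. *)
  move=> fz J; have := tc J; rewrite lecE => /andP[_]; apply: le_trans.
  rewrite -lecR RRe_real; last by rewrite ger0_real// sumr_ge0.
  rewrite /partial_sum rmorph_sum; apply: ler_sum => i _; exact: fz.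
have /cvg_ex[/= x cx] := abs_complete_real (bound _ (@normc_ge_Re R)).
have /cvg_ex[/= y cy] := abs_complete_real (bound _ (@normc_ge_Im R)).
apply: (@dist_lt_is_cvg _ _ _ _ _ (x +i* y)) => e e0.
have [er eE] : exists er, e = er%:C.
  by exists (complex.Re e); rewrite RRe_real// gtr0_real.
move: e0; rewrite {}eE ltcR => er0.
have er2 : 0 < er / 2 by rewrite divr_gt0.
near=> J.
apply: (le_lt_trans (normc_le_ReIm _)); rewrite ltcR partial_sum_complex /=.
rewrite [ltRHS](splitr er) ltrD//; near: J.
  by move/cvgrPdist_lt: cx; apply.
by move/cvgrPdist_lt: cy; apply.
Unshelve. all: by end_near. Qed.

(** * Infinite products *)

(** Transfers a limit over all finite sets to a concrete exhaustion, such as initial segments or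
    boxes: a finite set is absorbed one element at a time. *)
Lemma cvg_totally (I : choiceType) (T : Type) (F : set_system T) (B : T -> {fset I}) :
  Filter F -> (forall i, \forall n \near F, i \in B n) -> B @ F --> totally.
Proof.
move=> FF BF P [J _ JP].
suff : \forall n \near F, (J `<=` B n)%fset by apply: filterS => n /JP.
have : \forall n \near F, {in (J : seq I), forall i, i \in B n}.
  elim: (J : seq I) => [|i s IH]; first exact: nearW.
  apply: filterS2 (BF i) IH => n iB sB j; rewrite inE => /orP[/eqP->//|].
  exact: sB.
by apply: filterS => n h; apply/fsubsetP => i; exact: h.
Qed.

Section QProducts.
Variable K : numFieldType.
Hypothesis K_complete : abs_complete K.

Implicit Types x y q : K.

Lemma sum_geometric y n : y != 1 -> \sum_(i < n) y ^+ i = (1 - y ^+ n) / (1 - y).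
Proof.
move=> y1; have y0 : 1 - y != 0 by rewrite subr_eq0 eq_sym.
by apply: (mulIf y0); rewrite divfK// mulrC -[1 - y]opprB mulNr -subrX1 opprB.
Qed.

Lemma lt1_neq1 y : `|y| < 1 -> y != 1.
Proof. by apply: contraTneq => ->; rewrite normr1 ltxx. Qed.

Lemma sum_geometric_le y n : 0 <= y -> y < 1 -> \sum_(i < n) y ^+ i <= (1 - y)^-1.
Proof.
move=> y0 y1; rewrite sum_geometric ?lt_eqF// ler_piMl//.
  by rewrite invr_ge0 subr_ge0 ltW.
by rewrite gerBl exprn_ge0.
Qed.

Lemma summable_nat (t : nat -> K) (c : K) :
  (forall n, \sum_(i < n) `|t i| <= c) -> cvg (\sum_(i < n) t i @[n --> \oo]).
Proof.
move=> tc; have /K_complete/cvg_ex[/= l tl] (J : {fset nat}) :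
    partial_sum (fun i => `|t i|) J <= c.
  apply: le_trans (tc (\max_(i <- J) i).+1).
  rewrite partial_sumE -(big_mkord xpredT (fun i => `|t i|)).
  apply: ler_sum_sub => //; rewrite ?fset_uniq ?iota_uniq// => i iJ.
  by rewrite mem_index_iota ltnS /= (leq_bigmax_seq i).
apply/cvg_ex; exists l.
have -> : (fun n => \sum_(i < n) t i)
        = partial_sum t \o (fun n => [fset i | i in iota 0 n]%fset).
  apply/funext => n /=; rewrite partial_sumE -(big_mkord xpredT t).
  apply: perm_big; apply: uniq_perm; rewrite ?iota_uniq ?fset_uniq// => i.
  by rewrite in_fset /index_iota subn0.
apply: cvg_comp tl; apply: cvg_totally => i.
by exists i.+1 => // n /= lein; rewrite in_fset mem_iota.
Qed.

(** An abstract [numFieldType] may be non-archimedean, so this rests on completeness: the geometric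
    series converges, and [y ^+ n] is the difference of two consecutive partial sums. *)
Lemma cvg_expr0 y : `|y| < 1 -> y ^+ n @[n --> \oo] --> (0 : K).
Proof.
move=> y1.
have /summable_nat/cvg_ex[/= l cl] n : \sum_(i < n) `|y ^+ i| <= (1 - `|y|)^-1.
  by under eq_bigr do rewrite normrX; exact: sum_geometric_le.
have cl1 : \sum_(i < n.+1) y ^+ i @[n --> \oo] --> l.
  by rewrite (cvg_shiftS (fun n => \sum_(i < n) y ^+ i)).
rewrite (_ : (fun n => y ^+ n) = (fun n => \sum_(i < n.+1) y ^+ i - \sum_(i < n) y ^+ i)).
  by rewrite -[X in _ --> X](subrr l); exact: cvgB.
by apply/funext => n; rewrite big_ord_recr addrC addKr.
Qed.

(** The Weierstrass product inequality for the factors [1 - x q^i]. *)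
Lemma qprod_lower_small x q : 0 <= x <= 1 -> 0 <= q <= 1 -> forall n,
  1 - x * \sum_(i < n) q ^+ i <= \prod_(i < n) (1 - x * q ^+ i).
Proof.
move=> /andP[x0 x1] /andP[q0 q1]; elim=> [|n IH]; first by rewrite !big_ord0 mulr0 subr0.
rewrite !big_ord_recr /= mulrDr opprD addrA.
have xq0 : 0 <= x * q ^+ n by rewrite mulr_ge0 ?exprn_ge0.
have xq1 : x * q ^+ n <= 1 by rewrite mulr_ile1 ?exprn_ge0 ?exprn_ile1.
apply: le_trans (ler_wpM2r _ IH); last by rewrite subr_ge0.
rewrite mulrBr mulr1 lerD2l lerN2 ler_piMl// gerBl mulr_ge0// sumr_ge0// => i _.
exact: exprn_ge0.
Qed.

(** Once [x / (1 - q)] is at most 1/2, the preceding inequality gives the bound 1/2. Otherwise the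
    first factor [1 - x] is split off, which replaces [x] by [x q]; the induction is on the number
    [N] of factors to split off. *)
Lemma qprod_lower x q : 0 <= x < 1 -> 0 <= q < 1 ->
  exists2 c, 0 < c & forall n, c <= \prod_(i < n) (1 - x * q ^+ i).
Proof.
move=> /andP[x0 x1] /andP[q0 q1].
have [N small] : exists N, x * q ^+ N / (1 - q) <= 2^-1.
  have e0 : 0 < (1 - q) / 2 by rewrite divr_gt0 ?subr_gt0.
  have q1' : `|q| < 1 by rewrite ger0_norm.
  have /cvgrPdist_lt/(_ _ e0)[N _ /(_ N (leqnn N))] := cvg_expr0 q1'.
  rewrite sub0r normrN normrX ger0_norm// => /ltW qN; exists N.
  rewrite ler_pdivrMr ?subr_gt0// mulrC [leRHS]mulrC.
  by apply: le_trans qN; apply: ler_piMr; rewrite ?exprn_ge0// ltW.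
elim: N x x0 x1 small => [|N IH] x x0 x1 small.
  exists 2^-1; first by rewrite invr_gt0.
  move=> n; have x01 : 0 <= x <= 1 by rewrite x0 ltW.
  have q01 : 0 <= q <= 1 by rewrite q0 ltW.
  apply: le_trans (qprod_lower_small x01 q01 n).
  have half : 1 - 2^-1 = 2^-1 :> K by rewrite [X in X - _]splitr mul1r addrK.
  rewrite lerBrDr -lerBrDl half; apply: le_trans small.
  by rewrite expr0 mulr1 ler_wpM2l// sum_geometric_le.
have [|||c c0 cn] := IH (x * q).
- exact: mulr_ge0.
- by apply: le_lt_trans x1; apply: ler_piMr => //; exact: ltW.
- by rewrite -[x * q * _]mulrA -exprS.
exists ((1 - x) * c); first by rewrite mulr_gt0 ?subr_gt0.
(* The empty product has no first factor to split off; there [(1 - x) * c <= 1] is needed. *)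
have c1 : c <= 1 by have := cn 0%N; rewrite big_ord0.
case=> [|n].
  rewrite big_ord0; apply: mulr_ile1 => //; [|exact: ltW|by rewrite gerBl].
  by rewrite subr_ge0 ltW.
rewrite big_ord_recl expr0 mulr1; apply: ler_wpM2l; first by rewrite subr_ge0 ltW.
under eq_bigr do rewrite lift0 exprS mulrA.
exact: cn.
Qed.

(** With [y = |x| |q|^i], the reverse triangle inequality gives [|1 - x q^i| >= 1 - y], and
    [(1 + y)(1 - y) <= 1] turns the lower bound on the product of the [1 - y] into an upper bound on
    that of the [1 + y]. *)
Lemma qprod_norm_bounds x q : `|x| < 1 -> `|q| < 1 ->
  exists2 c, 0 < c & forall n,
    c <= `|\prod_(i < n) (1 - x * q ^+ i)| /\
    \prod_(i < n) (1 + `|x| * `|q| ^+ i) <= c^-1.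
Proof.
move=> x1 q1.
have [||c c0 cn] := @qprod_lower `|x| `|q|; rewrite ?normr_ge0//.
have lt1 i : `|x| * `|q| ^+ i < 1.
  by rewrite (le_lt_trans _ x1)// ler_piMr// exprn_ile1// ltW.
exists c => // n; split.
  apply: le_trans (cn n) _; rewrite normr_prod; apply: ler_prod => i _.
  rewrite subr_ge0 ltW//= -normrX -normrM.
  by rewrite -{1}(normr1 K) lerB_dist.
rewrite -[leRHS]div1r ler_pdivlMr//.
apply: le_trans (ler_wpM2l _ (cn n)) _.
  by apply: prodr_ge0 => i _; rewrite addr_ge0// mulr_ge0// exprn_ge0.
rewrite -big_split /=; apply: prodr_ile1 => i _.
have y0 : 0 <= `|x| * `|q| ^+ i by rewrite mulr_ge0// exprn_ge0.
apply/andP; split.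
  by apply: mulr_ge0; [exact: addr_ge0 | rewrite subr_ge0 ltW].
by rewrite mulrC -subr_sqr expr1n gerBl exprn_ge0.
Qed.

(** The product telescopes into a series whose terms [t i] are the differences of consecutive
    partial products; these are bounded by a constant times [|q|^i]. *)
Lemma qprod_cvg x q : `|x| < 1 -> `|q| < 1 ->
  \prod_(i < n) (1 - x * q ^+ i) @[n --> \oo] --> qpoch_inf x q.
Proof.
move=> x1 q1; have [c c0 cn] := qprod_norm_bounds x1 q1.
pose t i := - (x * q ^+ i * \prod_(j < i) (1 - x * q ^+ j)).
have tE n : \prod_(i < n) (1 - x * q ^+ i) = 1 + \sum_(i < n) t i.
  elim: n => [|n IH]; first by rewrite !big_ord0 addr0.
  by rewrite !big_ord_recr /= addrA -IH /t; ring.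
suff /cvg_ex[/= l tl] : cvg (\sum_(i < n) t i @[n --> \oo]).
  suff : cvg (\prod_(i < n) (1 - x * q ^+ i) @[n --> \oo]) by [].
  apply/cvg_ex; exists (1 + l); under eq_fun do rewrite tE.
  by apply: cvgD => //; exact: cvg_cst.
apply: (@summable_nat t (c^-1 * (1 - `|q|)^-1)) => n.
apply: le_trans (ler_wpM2l _ (sum_geometric_le n (normr_ge0 q) q1)); last first.
  by rewrite invr_ge0 ltW.
rewrite mulr_sumr; apply: ler_sum => i _.
rewrite normrN !normrM normrX -mulrA mulrC -mulrA [X in _ * X]mulrC.
have le1 : `|\prod_(j < i) (1 - x * q ^+ j)| <= c^-1.
  apply: le_trans (cn i).2; rewrite normr_prod; apply: ler_prod => j _.
  rewrite normr_ge0 /= (le_trans (ler_normB _ _))// normr1 normrM normrX//.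
have ci0 : 0 <= c^-1 by rewrite invr_ge0 ltW.
rewrite mulrC -mulrA.
rewrite (le_trans (ler_piMl _ (ltW x1)))// ?mulr_ge0 ?exprn_ge0//.
by rewrite ler_wpM2r// exprn_ge0.
Qed.

(** The partial products stay at distance at least [c] from 0. *)
Lemma qpoch_inf_neq0 x q : `|x| < 1 -> `|q| < 1 -> qpoch_inf x q != 0.
Proof.
move=> x1 q1; have [c c0 cn] := qprod_norm_bounds x1 q1.
apply/eqP => L0; have := qprod_cvg x1 q1; rewrite L0.
move=> /cvgrPdist_lt/(_ _ c0)[N _ /(_ N (leqnn N))].
by rewrite sub0r normrN; move/(le_lt_trans (cn N).1); rewrite ltxx.
Qed.

(** The infinite product is the product of its first [n] factors times the infinite product started
    at [x q^n], which is nonzero and cancels. *)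
Lemma qpochE x q n : `|x| < 1 -> `|q| < 1 ->
  qpoch x q n = \prod_(i < n) (1 - x * q ^+ i).
Proof.
move=> x1 q1.
have xq1 : `|x * q ^+ n| < 1.
  by rewrite normrM normrX (le_lt_trans _ x1)// ler_piMr// exprn_ile1// ltW.
apply: (mulIf (qpoch_inf_neq0 xq1 q1)); rewrite /qpoch divfK ?qpoch_inf_neq0//.
have h1 : \prod_(i < m + n) (1 - x * q ^+ i) @[m --> \oo] --> qpoch_inf x q.
  by rewrite (cvg_shiftn n (fun m => \prod_(i < m) (1 - x * q ^+ i))); exact: qprod_cvg.
apply: (cvg_unique _ h1); first exact: norm_hausdorff.
rewrite /=.
have -> : (fun m => \prod_(i < m + n) (1 - x * q ^+ i)) =
  (fun m => \prod_(i < n) (1 - x * q ^+ i) * \prod_(i < m) (1 - x * q ^+ n * q ^+ i)).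
  apply/funext => m; rewrite addnC big_split_ord /=; congr (_ * _).
  by apply: eq_bigr => i _; rewrite exprD mulrA.
by apply: cvgM; [exact: cvg_cst | exact: qprod_cvg].
Qed.

End QProducts.

(** * Overpartitions as multiplicity functions *)

(** The order in which parts are listed: decreasing sizes, the overlined copy first. It fails
    between two copies of the same overlined part, so a pairwise ordered list cannot repeat one. *)
Definition part_order (x y : nat * bool) := (y.1 < x.1)%N || (x.1 == y.1) && ~~ y.2.

Lemma part_order_trans : transitive part_order.
Proof.
move=> [y b] [x c] [z d]; rewrite /part_order /=.
by case: b; case: c; case: d; lia.
Qed.

Lemma part_order_anti : antisymmetric part_order.
Proof.
move=> [x b] [y c]; rewrite /part_order /= => h.
have -> : x = y by lia.
by congr pair; case: b c h => [] [] //=; lia.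
Qed.

Lemma is_overpartitionE s :
  is_overpartition s = all (leq 1) (unzip1 s) && pairwise part_order s.
Proof.
rewrite /is_overpartition sorted_pairwise; last by move=> y x z /=; lia.
rewrite andbCA /unzip1 pairwise_map -pairwise_relI; congr (_ && _).
by apply: eq_pairwise => -[x b] [y c]; rewrite /part_order /=; case: c; lia.
Qed.

Definition block n (x : bool * nat) : seq (nat * bool) :=
  nseq x.1 (n, true) ++ nseq x.2 (n, false).

(* [f i] describes the parts of size [i.+1]: whether the overlined part is
   present, and the number of non-overlined parts. *)
Fixpoint assemble N (f : nat -> bool * nat) : seq (nat * bool) :=
  if N is n.+1 then block n.+1 (f n) ++ assemble n f else [::].

Lemma block_size n x y : y \in block n x -> y.1 = n.
Proof. by rewrite mem_cat !mem_nseq => /orP[] /andP[_ /eqP->]. Qed.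

Lemma assemble_size N f y : y \in assemble N f -> (0 < y.1 <= N)%N.
Proof.
elim: N => //= N IH; rewrite mem_cat => /orP[/block_size ->|/IH]; first by rewrite ltnSn.
by move=> /andP[-> /leqW].
Qed.

Lemma assemble_is_overpartition N f : is_overpartition (assemble N f).
Proof.
rewrite is_overpartitionE; apply/andP; split.
  by rewrite all_map; apply/allP => y /assemble_size /andP[].
elim: N => //= N IH; rewrite pairwise_cat IH andbT; apply/andP; split.
  apply/allrelP => x y /block_size xN /assemble_size yN.
  by rewrite /part_order xN ltnS; case/andP: yN => _ ->.
case: (f N) => b c; rewrite /block pairwise_cat /=; apply/and3P; split.
- by apply/allrelP => x y /nseqP[-> _] /nseqP[-> _]; rewrite /part_order /= eqxx orbT.
- by case: b.
- by elim: c => //= c IHc; rewrite IHc andbT all_nseq /part_order /= eqxx !orbT.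
Qed.

Definition assembled N f : overpartition :=
  Overpartition (assemble_is_overpartition N f).

Lemma count_assemble N f n b : count_mem (n, b) (assemble N f) =
  if (0 < n <= N)%N then (if b then nat_of_bool (f n.-1).1 else (f n.-1).2) else 0%N.
Proof.
elim: N => [|N IH] /=; first by case: n.
rewrite count_cat IH /block count_cat !count_nseq /= !xpair_eqE.
have [->|nN] := eqVneq n N.+1.
  by rewrite ltnn !leqnn /=; case: b {IH}; rewrite /= ?mul1n ?mul0n ?addn0.
by rewrite /= !mul0n !add0n (_ : (n <= N.+1)%N = (n <= N)%N)//; move: nN; lia.
Qed.

Lemma weight_assembled N f :
  weight (assembled N f) = (\sum_(i < N) i.+1 * ((f i).1 + (f i).2))%N.
Proof.
rewrite /weight /=; elim: N => [|N IH] /=; first by rewrite big_ord0.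
rewrite big_ord_recr /= -IH /unzip1 map_cat sumn_cat addnC; congr (_ + _)%N.
by rewrite /block map_cat !map_nseq sumn_cat !sumn_nseq -mulnDr.
Qed.

(** Inverse to [assembled], with the same shift: index [i] stands for size [i.+1]. *)
Definition code (p : overpartition) (i : nat) : bool * nat :=
  ((i.+1, true) \in parts p, count_mem (i.+1, false) p).

Lemma overpartition_part_gt0 (p : overpartition) x : x \in parts p -> (0 < x.1)%N.
Proof.
case: p => s /= hs xs; move: hs; rewrite is_overpartitionE all_map => /andP[/allP].
by move=> /(_ x xs).
Qed.

Lemma pairwise_part_order_count s n : pairwise part_order s ->
  count_mem (n, true) s = ((n, true) \in s).
Proof.
elim: s => //= x s IH /andP[/allP xs /IH ->]; rewrite inE eq_sym.
case: eqVneq => //= xn; case: (boolP (_ \in s)) => // /xs.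
by rewrite -xn /part_order /= ltnn andbF.
Qed.

Lemma overpartition_count_true (p : overpartition) n :
  count_mem (n, true) p = ((n, true) \in parts p).
Proof.
apply: pairwise_part_order_count.
by case: p => s /=; rewrite is_overpartitionE => /andP[].
Qed.

(** Both lists are sorted for a transitive antisymmetric relation, so being permutations of each
    other makes them equal. *)
Lemma overpartition_eq (p p' : overpartition) :
  (forall x, count_mem x p = count_mem x p') -> p = p'.
Proof.
move=> pp; apply: val_inj => /=; apply: (sorted_eq part_order_trans part_order_anti).
- by apply: pairwise_sorted; case: p {pp} => s /=; rewrite is_overpartitionE => /andP[].
- by apply: pairwise_sorted; case: p' {pp} => s /=; rewrite is_overpartitionE => /andP[].
- by apply/allP => x _ /=; rewrite pp.
Qed.

Lemma assembledK N f i : (i < N)%N -> code (assembled N f) i = f i.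
Proof.
move=> iN; have := overpartition_count_true (assembled N f) i.+1.
rewrite /code /= !count_assemble /= iN.
by case: (f i) => -[] c /=; case: (_ \in _).
Qed.

Lemma codeK N (p : overpartition) f :
  (forall x, x \in parts p -> (x.1 <= N)%N) ->
  (forall i, (i < N)%N -> f i = code p i) -> assembled N f = p.
Proof.
move=> pN fp; apply: overpartition_eq => -[n b] /=; rewrite count_assemble.
case: ifPn => [/andP[n0 nN]|nN].
  rewrite fp ?prednK// /code /= prednK//.
  by case: b; rewrite // overpartition_count_true.
apply/esym/count_memPn; apply: contra nN => h.
by have := overpartition_part_gt0 h; have := pN _ h => /= -> ->.
Qed.

(** * Boxes: sizes at most [N], multiplicities at most [M] *)

Section Box.
Variables N M : nat.
Notation box_index := {ffun 'I_N -> bool * 'I_M.+1}.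

Definition box_fun (f : box_index) (i : nat) : bool * nat :=
  if insub i is Some j then ((f j).1, (f j).2 : nat) else (false, 0%N).

Lemma box_funE (f : box_index) (i : 'I_N) : box_fun f i = ((f i).1, (f i).2 : nat).
Proof. by rewrite /box_fun valK. Qed.

Lemma box_inj : injective (fun f : box_index => assembled N (box_fun f)).
Proof.
move=> f g fg; apply/ffunP => i.
have := assembledK (box_fun f) (ltn_ord i); rewrite fg assembledK// !box_funE.
by case: (f i) (g i) => b c [b' c'] /= [-> /val_inj ->].
Qed.

Definition box : {fset overpartition} :=
  [fset p in [seq assembled N (box_fun f) | f : box_index]]%fset.

Lemma big_box (V : zmodType) (t : overpartition -> V) :
  partial_sum t box = \sum_(f : box_index) t (assembled N (box_fun f)).
Proof.
rewrite partial_sumE /box.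
have /(perm_big _) -> : perm_eq [fset p in [seq assembled N (box_fun f) | f : box_index]]%fset
    [seq assembled N (box_fun f) | f : box_index].
  apply: uniq_perm; rewrite ?fset_uniq//.
    by rewrite map_inj_uniq ?enum_uniq//; exact: box_inj.
  by move=> p; rewrite in_fset.
by rewrite /image_mem big_map big_enum.
Qed.

(** Each size is at most the weight, and each multiplicity at most the number of parts. *)
Lemma mem_box (p : overpartition) : (weight p <= N)%N -> (size p <= M)%N -> p \in box.
Proof.
move=> pN pM; rewrite in_fset; apply/mapP.
pose f : box_index := [ffun i : 'I_N => ((code p i).1, inord (code p i).2)].
exists f; first by rewrite mem_enum.
apply/esym/codeK => [[n b] h|i iN].
  apply: leq_trans pN; rewrite /weight; elim: (parts p) h => //= x s IH.
  by rewrite inE => /orP[/eqP <- /=|/IH]; lia.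
have := box_funE f (Ordinal iN); rewrite ffunE /= => ->; rewrite inordK//.
by rewrite ltnS (leq_trans _ pM)// count_size.
Qed.

End Box.

Lemma near_mem_box (p : overpartition) :
  \forall NM \near filter_prod \oo \oo, p \in box NM.1 NM.2.
Proof.
exists ([set N | (weight p <= N)%N], [set M | (size p <= M)%N]) => /=.
  by split; [exists (weight p) | exists (size p)].
by move=> [N M] [/= pN pM]; exact: mem_box.
Qed.

Lemma cvg_box : box NM.1 NM.2 @[NM --> filter_prod \oo \oo] --> totally.
Proof. by apply: cvg_totally => p; exact: near_mem_box. Qed.

(** * The condition for [z^m] as a condition on each size *)

Section Weights.
Variables (r A a : nat).
Hypotheses (ha : (1 <= a)%N) (haA : (a <= A)%N) (hr : (2 <= r)%N).

(** The boolean equality treats [n < m] and [n = m] together: the multiplicity reaches [r - 1]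
    exactly when [n < m]. *)
Definition allowed (m n : nat) (x : bool * nat) : bool :=
  (n == a %[mod A]) && (n <= m)%N ==> ~~ x.1 && ((r - 1 <= x.2)%N == (n < m)%N).

Lemma mem_Nmes_mes (m : nat) (p : overpartition) : (0 < m)%N -> m = a %[mod A] ->
  (Nmes r A a p /\ mes r A a p = m) <-> (forall i, allowed m i.+1 (code p i)).
Proof.
move=> m0 mA; have A1 : (1 <= A)%N by exact: leq_trans haA.
have [cand mesmin] := mesP a p A1 hr; split.
  move=> [Np mE] i; rewrite mE in cand mesmin.
  apply/implyP => /andP[/eqP iA im]; rewrite /code /=.
  case: cand => _ _ mt mf.
  move: im; rewrite leq_eqVlt => /orP[/eqP im|im].
    by rewrite im mt ltnn /= eqbF_neg -ltnNge.
  have it : (i.+1, true) \notin parts p.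
    by apply/negP => h; have := Np _ h iA; rewrite mE => /(_ im).
  rewrite it im /= eqb_id leqNgt; apply/negP => h.
  (* With no overlined copy and fewer than [r - 1] plain ones, [i.+1] would be a candidate below the
     least one. *)
  have : mes_candidate r A a p i.+1 by split.
  by move/mesmin; lia.
move=> al.
have cm : mes_candidate r A a p m.
  have := al m.-1; rewrite /allowed prednK// mA eqxx leqnn ltnn /= prednK// => /andP[h1 h2].
  by split => //; move: h2; rewrite eqbF_neg -ltnNge.
have noc n : mes_candidate r A a p n -> (m <= n)%N.
  move=> [n0 nA nt nf]; rewrite leqNgt; apply/negP => nm.
  have := al n.-1; rewrite /allowed prednK// nA eqxx (ltnW nm) nm /= prednK// => /andP[_].
  by rewrite leqNgt nf.
have mE : mes r A a p = m by apply/eqP; rewrite eqn_leq mesmin//= noc.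
split => // -[n b] h /= nA; rewrite mE => nm; case: b h => // h.
have n0 := overpartition_part_gt0 h; have := al n.-1.
by rewrite /allowed prednK// nA eqxx (ltnW nm) nm /= prednK// h.
Qed.

End Weights.

(** * Sizes in the residue class of [a] *)

Lemma mes_mod_index (A a m : nat) : (0 < a)%N -> (a <= A)%N ->
  (0 < m)%N -> m = a %[mod A] -> exists k, m = (k * A + a)%N.
Proof.
(* Since [a] ranges over 1..A, the value [a = A] has residue 0; there [0 < m] rules out the zero
   multiple. *)
move=> ha haA m0; have [->|aA] := eqVneq a A.
  rewrite modnn => /eqP/dvdnP[[|k] mE]; first by rewrite mE in m0.
  by exists k; rewrite mE mulSn addnC.
rewrite (modn_small (m := a)) ?ltn_neqAle ?aA// => mE.
by exists (m %/ A)%N; rewrite -mE -divn_eq.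
Qed.

(** Cut the sizes into a first stretch of length [a] and then stretches of length [A]; each contains
    exactly one member of the class, at its end. *)
Lemma prod_residue_class (A a : nat) (K : comNzRingType) (F : nat -> K) k :
  (1 <= a)%N -> (a <= A)%N ->
  \prod_(i < k * A + a) (if i.+1 == a %[mod A] then F i.+1 else 1)
  = \prod_(j < k.+1) F (j * A + a)%N.
Proof.
move=> ha haA; have A1 : (1 <= A)%N by exact: leq_trans haA.
have last n m : (forall i, (i < m)%N -> (n + i).+1 != a %[mod A]) ->
    (n + m).+1 == a %[mod A] ->
    \prod_(i < n + m.+1) (if i.+1 == a %[mod A] then F i.+1 else 1)
    = \prod_(i < n) (if i.+1 == a %[mod A] then F i.+1 else 1) * F (n + m).+1.
  move=> no yes; rewrite big_split_ord /= big_ord_recr /= yes.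
  rewrite [X in _ * (X * _)]big1; first by rewrite mul1r.
  by move=> i _; rewrite (negbTE (no _ (ltn_ord i))).
elim: k => [|k IH].
  rewrite big_ord1 !mul0n add0n; have := last 0%N a.-1.
  rewrite !add0n prednK// big_ord0 mul1r.
  apply => // i ia; rewrite add0n.
  have iA : (i.+1 < A)%N by lia.
  have [aA|Aa] := ltnP a A; first by rewrite !modn_small//; lia.
  have -> : a = A by lia.
  by rewrite modnn modn_small.
rewrite big_ord_recr -IH /=.
rewrite (_ : k.+1 * A + a = k * A + a + A.-1.+1)%N; last by rewrite prednK//; lia.
rewrite last; [by congr (_ * F _); lia | |].
  move=> i iA; apply/negP; rewrite -addnA -addnS modnMDl addnC -addSn addnC => /eqP h.
  (* Adding [A - a] to both sides gives [i.+1 = 0] modulo [A], impossible for [0 < i.+1 < A]. *)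
  have := congr1 (fun x => (x + (A - a)) %% A)%N h.
  rewrite !modnDml -addnA; have -> : (a + (i.+1 + (A - a)) = i.+1 + A)%N by lia.
  by rewrite subnKC// modnDr modnn modn_small; lia.
by rewrite -addnS prednK// modnDr modnMDl.
Qed.

(** * The generating function *)

Lemma sum_box_prod (K : comNzRingType) (F : nat -> bool * nat -> K) N M :
  \sum_(f : {ffun 'I_N -> bool * 'I_M.+1}) \prod_(i < N) F i (box_fun f i) =
  \prod_(i < N) \sum_(x : bool * 'I_M.+1) F i (x.1, x.2 : nat).
Proof.
by rewrite bigA_distr_bigA; apply: eq_bigr => f _; apply: eq_bigr => i _; rewrite box_funE.
Qed.

Lemma sum_bool_ord (V : zmodType) (F : bool * nat -> V) M :
  \sum_(x : bool * 'I_M) F (x.1, x.2 : nat) =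
  \sum_(c < M) F (true, c : nat) + \sum_(c < M) F (false, c : nat).
Proof.
by rewrite -(pair_bigA _ (fun b (c : 'I_M) => F (b, c : nat))) /= big_bool.
Qed.

Lemma sum_bool_ord_expr (K : comNzRingType) (y : K) M :
  \sum_(x : bool * 'I_M) y ^+ (x.1 + x.2) = (1 + y) * \sum_(c < M) y ^+ c.
Proof.
rewrite (sum_bool_ord (fun x => y ^+ (x.1 + x.2))) mulrDl mul1r addrC mulr_sumr.
by congr (_ + _); apply: eq_bigr => c _; rewrite /= ?add1n ?exprS.
Qed.

Lemma cvg_partial_sum_single (K : numFieldType) (I : choiceType) (t : I -> K) (k : I) :
  (forall j, j != k -> t j = 0) -> partial_sum t @ totally --> t k.
Proof.
move=> tk; apply: cvg_near_cst; exists [fset k]%fset => // J /=.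
rewrite fsub1set => kJ; rewrite partial_sumE (bigD1_seq k) ?fset_uniq//=.
by rewrite big1 ?addr0.
Qed.

(** For each large [N], some [M] depending on [N] makes [f (N, M)] close both to [l] and to
    [g N]. *)
Lemma cvg_iterated (K : numFieldType) (f : nat * nat -> K) (g : nat -> K) (l : K) :
  f @ filter_prod \oo \oo --> l ->
  (\forall N \near \oo, f (N, M) @[M --> \oo] --> g N) -> g @ \oo --> l.
Proof.
move=> fl fg; apply/cvgrPdist_lt => e e0.
have e2 : 0 < e / 2 by rewrite divr_gt0.
move/cvgrPdist_lt: fl => /(_ _ e2)[[P Q] /= [oP oQ] PQ].
apply: filterS2 oP fg => N PN /cvgrPdist_lt/(_ _ e2) fN.
have [M [QM fM]] := filter_ex (filterI oQ fN).
rewrite (splitr e) (_ : l - g N = (l - f (N, M)) - (g N - f (N, M))); last by ring.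
by rewrite (le_lt_trans (ler_normB _ _))// ltrD//; exact: (PQ (N, M)).
Qed.

(** The sum of the first [k] sizes of the class; [r - 1] copies of each give the exponent in the
    theorem. *)
Lemma sum_arith (A a k : nat) : (\sum_(j < k) (j * A + a) = A * 'C(k, 2) + k * a)%N.
Proof.
elim: k => [|k IH]; first by rewrite big_ord0 bin0n muln0.
by rewrite big_ord_recr /= IH binS bin1; lia.
Qed.

(** * The coefficient of [z^m] *)

Section GeneratingFunction.
Variables (K : numFieldType) (q : K) (r A a : nat).
Hypothesis K_complete : abs_complete K.
Hypotheses (hq : `|q| < 1) (ha : (1 <= a)%N) (haA : (a <= A)%N) (hr : (2 <= r)%N).

Lemma norm_exprS_lt1 n : `|q ^+ n.+1| < 1.
Proof. by rewrite normrX exprn_ilt1. Qed.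

Lemma onePexpr_neq0 n : 1 + q ^+ n.+1 != 0.
Proof.
rewrite addrC addr_eq0; apply: contraTneq (norm_exprS_lt1 n) => ->.
by rewrite normrN normr1 ltxx.
Qed.

Definition coef_term (m : nat) (p : overpartition) : K :=
  if p \in Nmes r A a then zmonomial (mes r A a p) (q ^+ weight p) m else 0.

Definition part_weight (m i : nat) (x : bool * nat) : K :=
  if allowed r A a m i.+1 x then q ^+ (i.+1 * (x.1 + x.2)) else 0.

(** As [m <= N], every constrained size lies in the box. If one size violates its constraint, both
    sides vanish; otherwise the weight is additive over sizes. *)
Lemma coef_term_assembled m N f : (0 < m)%N -> m = a %[mod A] -> (m <= N)%N ->
  coef_term m (assembled N f) = \prod_(i < N) part_weight m i (f i).
Proof.
move=> m0 mA mN; have iffm := mem_Nmes_mes ha haA hr (assembled N f) m0 mA.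
have [/forallP al|/forallPn[/= i nal]] :=
    boolP [forall i : 'I_N, allowed r A a m i.+1 (f i)].
  have [|Np mE] := iffm.2.
    move=> i; have [iN|Ni] := ltnP i N.
      by rewrite assembledK//; exact: (al (Ordinal iN)).
    by rewrite /allowed (_ : (i.+1 <= m)%N = false) ?andbF//; lia.
  rewrite /coef_term mem_set// /zmonomial mE eqxx weight_assembled expr_sum.
  by apply: eq_bigr => i _; rewrite /part_weight al.
rewrite (bigD1 i)//= {1}/part_weight (negbTE nal) mul0r /coef_term.
case: ifP => // /set_mem Np; rewrite /zmonomial; case: eqP => // mE.
by move: nal; rewrite -(assembledK f (ltn_ord i)) (iffm.1 (conj Np (esym mE))).
Qed.

Lemma norm_coef_term m p : `|coef_term m p| <= `|q| ^+ weight p.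
Proof.
rewrite /coef_term /zmonomial.
by case: ifP => _; [case: ifP => _|]; rewrite ?normr0 ?exprn_ge0// normrX.
Qed.

(** Each finite set lies in a box, where the sum of [|q|^weight] factors; it is at most the product
    of the [(1 + |q|^n) / (1 - |q|^n)], bounded uniformly in the box. *)
Lemma coef_term_bounded : exists c, forall m (J : {fset overpartition}),
  partial_sum (fun p => `|coef_term m p|) J <= c.
Proof.
set Q := `|q|; have Q0 : 0 <= Q by exact: normr_ge0.
have [||c1 c10 low] := @qprod_lower K K_complete Q Q; rewrite ?Q0//.
have [c2 c20 upp] := qprod_norm_bounds K_complete hq hq.
exists (c2^-1 * c1^-1) => m J.
have [[N M] /= JNM] : exists NM, (J `<=` box NM.1 NM.2)%fset.
  apply: (@filter_ex _ (filter_prod \oo \oo)).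
  by have := @cvg_box [set B | (J `<=` B)%fset]; apply; exists J.
apply: (@le_trans _ _ (partial_sum (fun p => Q ^+ weight p) J)).
  by apply: ler_sum => p _; exact: norm_coef_term.
apply: le_trans (partial_sum_le _ JNM) _; first by move=> p; exact: exprn_ge0.
rewrite big_box.
under eq_bigr do rewrite weight_assembled expr_sum.
rewrite (sum_box_prod (fun i x => Q ^+ (i.+1 * (x.1 + x.2)))).
apply: (@le_trans _ _ (\prod_(i < N) ((1 + Q * Q ^+ i) * (1 - Q * Q ^+ i)^-1))).
  apply: ler_prod => i _; apply/andP; split.
    by apply: sumr_ge0 => x _; exact: exprn_ge0.
  under eq_bigr do rewrite exprM.
  rewrite sum_bool_ord_expr -exprS ler_wpM2l//.
    by rewrite addr_ge0 ?exprn_ge0.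
  by rewrite sum_geometric_le ?exprn_ge0// exprn_ilt1.
rewrite big_split /= prodfV; apply: ler_pM.
- by apply: prodr_ge0 => i _; rewrite addr_ge0// mulr_ge0// exprn_ge0.
- by rewrite invr_ge0; apply: le_trans (low N); exact: ltW.
- exact: (upp N).2.
- by rewrite lef_pV2 ?low// posrE; exact: lt_le_trans (low N).
Qed.

Lemma coef_term_summable m : cvg (partial_sum (coef_term m) @ totally).
Proof. by have [c cP] := coef_term_bounded; exact: K_complete (cP m). Qed.

Lemma cvg_geometric_sum (y : K) : `|y| < 1 ->
  \sum_(c < M.+1) y ^+ c @[M --> \oo] --> (1 - y)^-1.
Proof.
move=> y1; rewrite (cvg_shiftS (fun M => \sum_(c < M) y ^+ c)).
rewrite (_ : (1 - y)^-1 = (1 - 0) / (1 - y)); last by rewrite subr0 mul1r.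
under eq_fun do rewrite sum_geometric ?lt1_neq1//.
apply: cvgM; last exact: cvg_cst.
apply: cvgB; first exact: cvg_cst.
exact: cvg_expr0.
Qed.

Lemma cvg_geometric_head (y : K) s : `|y| < 1 ->
  \sum_(c < M.+1) (if (s <= c)%N == false then y ^+ c else 0) @[M --> \oo]
    --> (1 - y ^+ s) / (1 - y).
Proof.
move=> y1; apply: cvg_near_cst; exists s => // M /= sM.
rewrite -sum_geometric ?lt1_neq1// -[in LHS](subnKC (leqW sM)) big_split_ord /=.
rewrite [X in _ + X]big1 ?addr0; last by move=> i _; rewrite leq_addr.
by apply: eq_bigr => i _; rewrite leqNgt ltn_ord.
Qed.

Lemma cvg_geometric_tail (y : K) s : `|y| < 1 ->
  \sum_(c < M.+1) (if (s <= c)%N == true then y ^+ c else 0) @[M --> \oo]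
    --> y ^+ s / (1 - y).
Proof.
move=> y1.
rewrite (_ : (fun M => _) = (fun M => \sum_(c < M.+1) y ^+ c -
    \sum_(c < M.+1) (if (s <= c)%N == false then y ^+ c else 0))); last first.
  apply/funext => M; rewrite -sumrB; apply: eq_bigr => c _.
  by case: (s <= c)%N; rewrite /= ?subr0 ?subrr.
rewrite (_ : y ^+ s / (1 - y) = (1 - y)^-1 - (1 - y ^+ s) / (1 - y)); last by ring.
by apply: cvgB; [exact: cvg_geometric_sum | exact: cvg_geometric_head].
Qed.

(** The local generating function under the constraint divided by the free one,
    [(1 + q^n) / (1 - q^n)]. *)
Definition correction (m n : nat) : K :=
  if n == a %[mod A] then
    (if (n < m)%N then q ^+ ((r - 1) * n) else 1 - q ^+ ((r - 1) * n)) / (1 + q ^+ n)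
  else 1.

Definition part_weight_sum (m i : nat) : K :=
  (1 + q ^+ i.+1) / (1 - q ^+ i.+1) * (if (i < m)%N then correction m i.+1 else 1).

Lemma cvg_part_weight m i :
  \sum_(x : bool * 'I_M.+1) part_weight m i (x.1, x.2 : nat) @[M --> \oo]
    --> part_weight_sum m i.
Proof.
have y1 := norm_exprS_lt1 i; set y := q ^+ i.+1 in y1.
have yn0 : 1 + y != 0 := onePexpr_neq0 i.
rewrite /part_weight_sum /correction /part_weight /allowed -/y /=.
have [/andP[iA im]|] := boolP ((i.+1 == a %[mod A]) && (i < m)%N); last first.
  move=> nai; rewrite (_ : (if (i < m)%N then _ else 1) = 1); last first.
    by case: ifP nai => // _; rewrite andbT => /negbTE ->.
  rewrite (_ : (fun M => _) = (fun M => (1 + y) * \sum_(c < M.+1) y ^+ c)).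
    by rewrite mulr1; apply: cvgM; [exact: cvg_cst | exact: cvg_geometric_sum].
  apply/funext => M; rewrite -sum_bool_ord_expr.
  by apply: eq_bigr => c _; rewrite /= exprM.
rewrite im iA /=.
rewrite (_ : (fun M => _) = (fun M =>
    \sum_(c < M.+1) (if (r - 1 <= c)%N == (i.+1 < m)%N then y ^+ c else 0))); last first.
  apply/funext => M; rewrite (sum_bool_ord (fun x : bool * nat =>
    if ~~ x.1 && ((r - 1 <= x.2)%N == (i.+1 < m)%N) then q ^+ (i.+1 * (x.1 + x.2)) else 0)).
  (* The overlined half of the sum vanishes. *)
  rewrite big1 ?add0r//.
  by apply: eq_bigr => c _; rewrite add0n exprM.
rewrite mulnC exprM -/y (_ : _ * (_ / _) =
    (if (i.+1 < m)%N then y ^+ (r - 1) else 1 - y ^+ (r - 1)) / (1 - y)); last first.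
  by rewrite mulrC mulrA divfK.
by case: (i.+1 < m)%N; [exact: cvg_geometric_tail | exact: cvg_geometric_head].
Qed.

Lemma cvg_prod_part_weight m N :
  \prod_(i < N) \sum_(x : bool * 'I_M.+1) part_weight m i (x.1, x.2 : nat) @[M --> \oo]
    --> \prod_(i < N) part_weight_sum m i.
Proof.
elim: N => [|N IH].
  by under eq_fun do rewrite big_ord0; rewrite big_ord0; exact: cvg_cst.
under eq_fun do rewrite big_ord_recr /=.
by rewrite big_ord_recr /=; apply: cvgM => //; exact: cvg_part_weight.
Qed.

(** The corrections stop at size [m], so their product is constant for [N >= m]; the free factors
    give the two infinite products. *)
Lemma cvg_prod_part_weight_sum m :
  \prod_(i < N) part_weight_sum m i @[N --> \oo]
    --> qpoch_inf (- q) q / qpoch_inf q q * \prod_(i < m) correction m i.+1.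
Proof.
have hqN : `|- q| < 1 by rewrite normrN.
rewrite (_ : (fun N => _) = (fun N => \prod_(i < N) (1 - - q * q ^+ i) /
    \prod_(i < N) (1 - q * q ^+ i) *
    \prod_(i < N) (if (i < m)%N then correction m i.+1 else 1))); last first.
  apply/funext => N; rewrite -prodfV -!big_split /=; apply: eq_bigr => i _.
  by rewrite /part_weight_sum mulNr opprK -exprS.
apply: cvgM; first apply: cvgM.
- exact: qprod_cvg.
- by apply: cvgV; [exact: qpoch_inf_neq0 | exact: qprod_cvg].
- apply: cvg_near_cst; exists m => // N /= mN.
  rewrite -(subnKC mN) big_split_ord /= [X in _ * X]big1 ?mulr1.
    by apply: eq_bigr => i _; rewrite ltn_ord.
  by move=> i _; rewrite ltnNge leq_addr.
Qed.

(** The unordered sum is the joint limit over boxes, hence the iterated one: first [M] for fixed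
    [N >= m], then [N]. *)
Lemma cvg_coef_term m : (0 < m)%N -> m = a %[mod A] ->
  partial_sum (coef_term m) @ totally
    --> qpoch_inf (- q) q / qpoch_inf q q * \prod_(i < m) correction m i.+1.
Proof.
move=> m0 mA; have /cvg_ex[/= l tl] := @coef_term_summable m.
suff /(cvg_unique (@norm_hausdorff _ _) (@cvg_prod_part_weight_sum m)) -> :
  \prod_(i < N) part_weight_sum m i @[N --> \oo] --> l by [].
apply: (@cvg_iterated _ (fun NM => partial_sum (coef_term m) (box NM.1 NM.2))).
  exact: cvg_comp cvg_box tl.
exists m => // N /= mN.
rewrite (_ : (fun M => _) = (fun M => \prod_(i < N)
    \sum_(x : bool * 'I_M.+1) part_weight m i (x.1, x.2 : nat))).
  exact: cvg_prod_part_weight.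
apply/funext => M; rewrite big_box -sum_box_prod.
by apply: eq_bigr => f _; exact: coef_term_assembled.
Qed.

(** Only the sizes [jA + a] with [j <= k] count. Those with [j < k] contribute the common power of
    [q]; the last contributes [1 - q^((r-1)(kA+a))], which splits the result into the two terms of
    the bracket. *)
Lemma prod_correction k :
  \prod_(i < k * A + a) correction (k * A + a) i.+1 =
  q ^+ ((r - 1) * (A * 'C(k, 2) + k * a)) / qpoch (- q ^+ a) (q ^+ A) k.+1
  - q ^+ ((r - 1) * (A * 'C(k.+1, 2) + k.+1 * a)) / qpoch (- q ^+ a) (q ^+ A) k.+1.
Proof.
have A1 : (1 <= A)%N by exact: leq_trans haA.
rewrite (prod_residue_class (fun n => (if (n < k * A + a)%N then q ^+ ((r - 1) * n)
  else 1 - q ^+ ((r - 1) * n)) / (1 + q ^+ n)) k ha haA).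
rewrite qpochE//; last 2 first.
- by rewrite normrN -(prednK ha) norm_exprS_lt1.
- by rewrite -(prednK A1) norm_exprS_lt1.
rewrite -mulrBl big_split /= prodfV; congr (_ / _); last first.
  by apply: eq_bigr => j _; rewrite mulNr opprK -exprM -exprD addnC mulnC.
rewrite -!sum_arith [in RHS]big_ord_recr /= mulnDr exprD -[X in X - _]mulr1 -mulrBr.
rewrite big_ord_recr /= ltnn; congr (_ * _).
rewrite big_distrr /= expr_sum; apply: eq_bigr => j _.
by rewrite ltn_add2r ltn_pmul2r// ltn_ord.
Qed.

End GeneratingFunction.

(** Compare coefficients of [z^m]. If [m = kA + a], the right-hand family has only the term at [k];
    for other [m] both sides are zero, because [mes] always has the form [kA + a]. *)
Lemma mes_generating_function (K : numFieldType) (q : K) (A a r : nat) :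
  abs_complete K -> `|q| < 1 -> (1 <= a)%N -> (a <= A)%N -> (2 <= r)%N ->
  let lhs_term := fun p : overpartition =>
    zmonomial (mes r A a p) (q ^+ weight p) in
  let rhs_term := fun k : nat =>
    zmonomial (k * A + a)%N
      (q ^+ ((r - 1) * (A * 'C(k, 2) + k * a)) / qpoch (- q ^+ a) (q ^+ A) k.+1
       - q ^+ ((r - 1) * (A * 'C(k.+1, 2) + k.+1 * a))
           / qpoch (- q ^+ a) (q ^+ A) k.+1) in
  [/\ zsummable (Nmes r A a) lhs_term,
      zsummable [set: nat] rhs_term &
      forall m : nat,
        zsum (Nmes r A a) lhs_term m =
        qpoch_inf (- q) q / qpoch_inf q q * zsum [set: nat] rhs_term m].
Proof.
move=> K_complete hq ha haA hr lhs_term rhs_term.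
have A1 : (1 <= A)%N by exact: leq_trans haA.
have sum_lim (I : choiceType) (t : I -> K) l : partial_sum t @ totally --> l -> sum t = l.
  by move=> tl; apply: cvg_lim => //; exact: norm_hausdorff.
pose rhs m k := if k \in [set: nat] then rhs_term k m else 0.
have rhsE k j : rhs (k * A + a)%N j = if j == k then rhs_term k (k * A + a)%N else 0.
  rewrite /rhs in_setT /rhs_term /zmonomial eqxx eqn_add2r eqn_pmul2r// eq_sym.
  by case: eqP => // ->.
have rhs_cvg k : partial_sum (rhs (k * A + a)%N) @ totally --> rhs_term k (k * A + a)%N.
  have := @cvg_partial_sum_single K _ (rhs (k * A + a)%N) k.
  by rewrite (rhsE k k) eqxx; apply => j jk; rewrite rhsE (negbTE jk).
have rhs_cvg0 m : ~ (exists k, m = (k * A + a)%N) -> partial_sum (rhs m) @ totally --> (0 : K).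
  move=> nk; have rhs0 j : rhs m j = 0.
    rewrite /rhs in_setT /rhs_term /zmonomial; case: eqP => // mj.
    by case: nk; exists j.
  by have := @cvg_partial_sum_single K _ (rhs m) 0%N (fun j _ => rhs0 j); rewrite rhs0.
split.
- by move=> m; exact: coef_term_summable.
- move=> m; have [[k ->]|/rhs_cvg0] := pselect (exists k, m = (k * A + a)%N).
    by apply/cvg_ex; exists (rhs_term k (k * A + a)%N); exact: rhs_cvg.
  by move=> h; apply/cvg_ex; exists 0.
- move=> m; have [[k ->]|nk] := pselect (exists k, m = (k * A + a)%N).
    rewrite [X in _ = _ * X](sum_lim _ _ _ (rhs_cvg k)).
    rewrite /rhs_term /zmonomial eqxx -prod_correction//.
    by apply: sum_lim; apply: cvg_coef_term => //; [lia | rewrite modnMDl].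
  rewrite [X in _ = _ * X](sum_lim _ _ _ (rhs_cvg0 _ nk)) mulr0; apply: sum_lim.
  have t0 p : coef_term q r A a m p = 0.
    rewrite /coef_term; case: ifP => // _; rewrite /zmonomial; case: eqP => // mE.
    case: nk; have [[m0 mA _ _] _] := mesP a p A1 hr.
    by rewrite mE; exact: mes_mod_index.
  (* The empty overpartition serves as an arbitrary index for a family that is zero everywhere. *)
  pose p0 := assembled 0 (fun=> (false, 0%N)).
  have := @cvg_partial_sum_single K _ (coef_term q r A a m) p0 (fun p _ => t0 p).
  by rewrite t0.
Qed.

Theorem theorem2p10 (R : realType) (q : R[i]) (A a r : nat)
    (hq : `|q| < 1) (ha : (1 <= a)%N) (haA : (a <= A)%N) (hr : (2 <= r)%N) :
  let lhs_term := fun p : overpartition =>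
    zmonomial (mes r A a p) (q ^+ weight p) in
  let rhs_term := fun k : nat =>
    zmonomial (k * A + a)%N
      (q ^+ ((r - 1) * (A * 'C(k, 2) + k * a)) / qpoch (- q ^+ a) (q ^+ A) k.+1
       - q ^+ ((r - 1) * (A * 'C(k.+1, 2) + k.+1 * a))
           / qpoch (- q ^+ a) (q ^+ A) k.+1) in
  [/\ zsummable (Nmes r A a) lhs_term,
      zsummable [set: nat] rhs_term &
      forall m : nat,
        zsum (Nmes r A a) lhs_term m =
        qpoch_inf (- q) q / qpoch_inf q q * zsum [set: nat] rhs_term m].
Proof. exact: (mes_generating_function (@abs_complete_complex R)). Qed.
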